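(* Let $(x_n)_{n\ge 0}$ be a sequence of integers satisfying $x_{n+1} = P(x_n)$ for all $n \ge 0$, where $P$ is a polynomial of degree $d > 1$ with rational coefficients. Assume that $x_n \to \infty$ as $n \to \infty$. Set $\alpha = \lim_{n\to\infty} \sqrt[d^n]{x_n}$. Then $\alpha$ is a real number greater than $1$, and $\alpha$ is either irrational or an integer. *)

(* Defs.v *)
From mathcomp Require Export all_boot all_order all_algebra.
From mathcomp Require Export all_classical all_reals all_analysis.
Export Order.TTheory GRing.Theory Num.Theory.
Export numFieldNormedType.Exports.

Set Implicit Arguments.
Unset Strict Implicit.
Unset Printing Implicit Defensive.

Local Open Scope classical_set_scope.
Local Open Scope ring_scope.

(* The sequence of roots (x n) ^ (1 / d ^ n). When x n is negative, [powR]
   returns the junk value 1; this can occur for finitely many n only when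
   x tends to +oo, so it does not affect the limit. *)
Definition iter_root (R : realType) (d : nat) (x : nat -> int) : R^nat :=
  fun n => (x n)%:~R `^ ((d ^ n)%:R)^-1.

(* Main.v *)
Require Import Defs.
From mathcomp Require Import ring lra zify.
Local Open Scope classical_set_scope.
Local Open Scope ring_scope.

(* Put e = d - 1 and a = lead_coef P.  The e-th power of the Boettcher
   coordinate of P at infinity, normalised as Theta(x) ~ x^e, is a Laurent
   series in 1/x with rational coefficients, and Theta(x_n) = u_n with
   u_n = alpha^(e d^n) / a.  For every M, a Pade approximant of Theta gives
   coprime integer polynomials F, G (F nonzero) with
   F(x_n) a u_n - G(x_n) = O(x_n^-M).  If alpha = p/q in lowest terms, then for
   M large the integer F(x_n) p^(e d^n) - G(x_n) q^(e d^n) tends to 0, hence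
   vanishes for n large.  By Bezout, F(x_n) = w_n q^(e d^n) with w_n bounded and
   nonzero; comparing with the growth |F(x_n)| ~ c x_n^k, k = deg F, yields
   alpha^k = q^e, that is p^k = q^(e + k), so q = 1. *)

(** * Degree bounds and top coefficients of products and powers *)

Lemma size_mul_bound (F : idomainType) (p q : {poly F}) (i j : nat) :
  (size p <= i.+1)%N -> (size q <= j.+1)%N -> (size (p * q)%R <= (i + j).+1)%N.
Proof.
move=> hp hq; apply: leq_trans (size_polyMleq _ _) _; lia.
Qed.

Lemma coef_mul_top (F : idomainType) (p q : {poly F}) (i j : nat) :
  (size p <= i.+1)%N -> (size q <= j.+1)%N -> (p * q)`_(i + j) = p`_i * q`_j.
Proof.
move=> hp hq; rewrite coefM.
have hi : (i < (i + j).+1)%N by lia.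
rewrite (bigD1 (Ordinal hi)) //= addKn big1 ?addr0 // => k.
rewrite -val_eqE /= => /eqP ki.
have [lt_ik|le_ki] := ltnP i k.
  by rewrite [p`_k]nth_default ?mul0r // (leq_trans hp).
by rewrite [q`_(_ - _)]nth_default ?mulr0 // (leq_trans hq) //; lia.
Qed.

Lemma size_exp_bound (F : idomainType) (p : {poly F}) (i n : nat) :
  (size p <= i.+1)%N -> (size (p ^+ n)%R <= (i * n).+1)%N.
Proof.
move=> hp; elim: n => [|n IHn]; first by rewrite expr0 size_poly1.
by rewrite exprS mulnS size_mul_bound.
Qed.

Lemma coef_exp_top (F : idomainType) (p : {poly F}) (i n : nat) :
  (size p <= i.+1)%N -> (p ^+ n)`_(i * n) = p`_i ^+ n.
Proof.
move=> hp; elim: n => [|n IHn]; first by rewrite !expr0 muln0 coef1.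
by rewrite !exprS mulnS coef_mul_top ?size_exp_bound // IHn.
Qed.

Lemma size_coef_top0 (F : idomainType) (p : {poly F}) (i : nat) :
  (size p <= i.+1)%N -> p`_i = 0 -> (size p <= i)%N.
Proof.
move=> /leq_sizeP hp pi0; apply/leq_sizeP => j.
by rewrite leq_eqVlt => /predU1P[<-|/hp].
Qed.

(** * Formal approximation at infinity: Boettcher recursion and Pade approximants *)

(* With [e = d - 1], the function [T / 'X^m] approximates, up to a relative
   error [O(x^-(m+1))], the solution [Theta(x) ~ x^e] at infinity of
   [Theta(P(x)) = (lead_coef P)^e * Theta(x)^d], the [e]-th power of a
   Boettcher coordinate; taking this power makes all coefficients lie in [F]. *)
Lemma boettcher_approx (F : numFieldType) (d m : nat) (P : {poly F}) :
  (1 < d)%N -> size P = d.+1 ->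
  exists T : {poly F}, [/\ T \is monic, size T = (m + d)%N &
    (size ((T \Po P) * 'X^(d * m)
           - lead_coef P ^+ d.-1 *: (T ^+ d * P ^+ m))%R
       <= d * (2 * m + d.-1) - m)%N].
Proof.
case: d => [//|e] e_gt0 szP; rewrite /= ltnS in e_gt0 *.
have aE : P`_(e.+1) = lead_coef P by rewrite lead_coefE szP.
set a := lead_coef P in aE *.
have a0 : a != 0 by rewrite lead_coef_eq0 -size_poly_eq0 szP.
elim: m => [|m [T [Tmon szT szS]]].
  (* For [m = 0] the error is [P^e - a^e X^(e d)]; the terms of degree [e d] cancel, which gives the
     required drop of one. *)
  exists 'X^e; rewrite monicXn size_polyXn; split=> //.
  rewrite muln0 !expr0 !mulr1 muln0 add0n subn0 comp_Xn_poly -exprM.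
  apply: size_coef_top0.
    rewrite (leq_trans (size_polyD _ _)) // geq_max size_exp_bound ?szP //=.
    by rewrite size_polyN (leq_trans (size_scale_leq _ _)) // size_polyXn mulnC.
  rewrite coefB coefZ coefXn coef_exp_top ?szP // aE.
  by rewrite mulnC eqxx mulr1 subrr.
set S := (X in size (polyseq X)) in szS.
(* [k] is the top degree allowed for the old error [S]. The new error will be seen to have degree at
   most [K], so only its coefficient at [K] remains to be killed. *)
pose K := (e.+1 * (2 * m.+1 + e) - m.+1)%N.
pose k := (e.+1 * (2 * m + e) - m).-1.
(* Passing from [T] to [W] adds [tau x^(e - m - 1)] to [T / X^m]. The coefficient at [K] becomes
   [a S_k - a^e tau a^(m+1) (e+1)], and [tau] is its zero; dividing by [e+1] is possible in
   characteristic zero. *)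
pose tau : F := a * S`_k / (a ^+ e * a ^+ m.+1 * e.+1%:R).
pose Y := T * 'X.
pose W := Y + tau *: 'X^e.
have Ysz : size Y = (m.+1 + e.+1)%N by rewrite size_mulX ?szT // monic_neq0.
have szX : (size (tau *: 'X^e : {poly F})%R <= e.+1)%N.
  by rewrite (leq_trans (size_scale_leq _ _)) // size_polyXn.
have Wsz : size W = (m.+1 + e.+1)%N.
  by rewrite size_polyDl Ysz // (leq_ltn_trans szX) //; lia.
have Ytop : Y`_(m.+1 + e) = 1.
  by rewrite coefMX /= -(eqP Tmon) lead_coefE szT addnS.
have Wtop : W`_(m.+1 + e) = 1.
  by rewrite coefD Ytop nth_default ?addr0 // (leq_trans szX) //; lia.
exists W; split=> //.
  by apply/eqP; rewrite lead_coefE Wsz addnS /= Wtop.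
(* The old error, rescaled by [P X^d], plus the effect of the correction on each side of the
   functional equation; on the power side [W^d - Y^d] is factored through [W - Y = tau X^e]. *)
have -> : (W \Po P) * 'X^(e.+1 * m.+1) - a ^+ e *: (W ^+ e.+1 * P ^+ m.+1)
  = P * 'X^(e.+1) * S + tau *: (P ^+ e * 'X^(e.+1 * m.+1))
    - (a ^+ e * tau) *: (P ^+ m.+1 * 'X^e
         * \sum_(i < e.+1) W ^+ (e.+1.-1 - i) * Y ^+ i).
  have -> : (a ^+ e * tau) *: (P ^+ m.+1 * 'X^e
         * \sum_(i < e.+1) W ^+ (e.+1.-1 - i) * Y ^+ i)
     = a ^+ e *: (P ^+ m.+1 * (W ^+ e.+1 - Y ^+ e.+1)).
    rewrite subrXX /W [Y + _ - Y]addrC addKr -!mul_polyC polyCM; ring.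
  rewrite /S /W /Y comp_polyD comp_polyM comp_polyZ comp_Xn_poly comp_polyX.
  rewrite -!mul_polyC exprMn mulnS !exprD !exprS; ring.
set Sg := \sum_(i < _) _.
have Wle : (size W <= (m.+1 + e).+1)%N by rewrite Wsz addnS.
have Yle : (size Y <= (m.+1 + e).+1)%N by rewrite Ysz addnS.
have summand (i : 'I_e.+1) : let Q := W ^+ (e.+1.-1 - i) * Y ^+ i in
    (size Q <= ((m.+1 + e) * e).+1)%N /\ Q`_((m.+1 + e) * e) = 1.
  have -> : ((m.+1 + e) * e = (m.+1 + e) * (e - i) + (m.+1 + e) * i)%N.
    by rewrite -mulnDr subnK // -ltnS.
  split; first by rewrite size_mul_bound ?size_exp_bound.
  by rewrite coef_mul_top ?size_exp_bound // !coef_exp_top // Wtop Ytop !expr1n mulr1.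
have Sgsz : (size Sg <= ((m.+1 + e) * e).+1)%N.
  by apply: (leq_trans (size_sum _ _ _)); apply/bigmax_leqP => i _; case: (summand i).
have Sgtop : Sg`_((m.+1 + e) * e) = e.+1%:R.
  rewrite coef_sum (eq_bigr (fun=> 1)) => [|i _]; last by case: (summand i).
  by rewrite sumr_const card_ord.
have kS : (size S <= k.+1)%N by rewrite /k; nia.
have K1 : K = (e.+1 + e.+1 + k)%N by rewrite /K /k; nia.
have K3 : K = (e.+1 * m.+1 + e + (m.+1 + e) * e)%N by rewrite /K; nia.
(* The correction composed with [P] has degree at most [d (e + m + 1)], which is below [K] because
   [e > 0]: it does not reach the coefficient at [K], so the equation for [tau] is linear. *)
have K2 : (e.+1 * e + e.+1 * m.+1 < K)%N by rewrite /K; nia.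
have sz1 : (size (P * 'X^(e.+1))%R <= (e.+1 + e.+1).+1)%N.
  by rewrite size_mul_bound ?szP ?size_polyXn.
have sz3 : (size (P ^+ m.+1 * 'X^e)%R <= (e.+1 * m.+1 + e).+1)%N.
  by rewrite size_mul_bound ?size_exp_bound ?szP ?size_polyXn.
have sz2 : (size (tau *: (P ^+ e * 'X^(e.+1 * m.+1)))%R <= K)%N.
  apply: (leq_trans (size_scale_leq _ _)); apply: leq_trans K2.
  by rewrite size_mul_bound ?size_exp_bound ?szP ?size_polyXn.
rewrite -/K; apply: size_coef_top0.
  rewrite (leq_trans (size_polyD _ _)) // geq_max; apply/andP; split.
    rewrite (leq_trans (size_polyD _ _)) // geq_max; apply/andP; split.
      by rewrite K1 size_mul_bound.
    exact: leq_trans sz2 (leqnSn _).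
  rewrite size_polyN (leq_trans (size_scale_leq _ _)) // K3.
  by rewrite size_mul_bound.
have c2 : (tau *: (P ^+ e * 'X^(e.+1 * m.+1)))`_K = 0 by rewrite nth_default.
rewrite coefB coefD c2 addr0 coefZ.
rewrite {1}K1 K3 !coef_mul_top ?size_exp_bound ?szP ?size_polyXn //.
rewrite coef_exp_top ?szP // !coefXn !eqxx aE Sgtop /tau.
by field; rewrite !expf_neq0 // nat1r pnatr_eq0.
Qed.

(** Counting unknowns: the [M] coefficients of [A] must make the [M - 1] coefficients of [A T] in
    degrees [m - M + 1] to [m - 1] vanish, and [B] collects the part of degree at least [m]. After
    division by [X^m] the remainder is [O(x^-M)]. *)
Lemma pade_approx (F : fieldType) (T : {poly F}) (M m : nat) :
  (0 < M <= m)%N ->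
  exists A B : {poly F}, [/\ A != 0, (size A <= M)%N &
    (size (A * T - B * 'X^m)%R <= (m - M).+1)%N].
Proof.
case: M => [//|M] /= Mm.
(* Here [M] stands for the original value minus one, so there is one more row than columns and the
   left kernel is nonzero. *)
pose Q := \matrix_(i < M.+1, j < M) ('X^i * T)`_(m - M + j).
have kerQ : kermx Q != 0.
  by rewrite kermx_eq0 /row_free neq_ltn (leq_ltn_trans (rank_leq_col Q)).
have [i v0] : exists i, row i (kermx Q) != 0.
  apply/existsP; apply: contraNT kerQ => /existsPn h.
  apply/eqP/row_matrixP => i; rewrite row0; exact/eqP/negPn/h.
set v := row _ _ in v0.
have vQ : v *m Q = 0 by apply/sub_kermxP; exact: row_sub.
exists (rVpoly v), (drop_poly m (rVpoly v * T)); split.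
- apply: contraNneq v0 => v0; by rewrite -(rVpolyK v) v0 linear0.
- exact: size_poly.
rewrite -[X in X - _](poly_take_drop m) addrK.
apply/leq_sizeP => j hj; rewrite coef_take_poly; case: ifP => // jm.
have hj' : (j - (m - M) < M)%N by lia.
move/rowP/(_ (Ordinal hj')): vQ; rewrite mxE [in X in _ = X]mxE => vQj.
rewrite -[RHS]vQj.
rewrite -[in LHS](@take_poly_id _ M.+1 (rVpoly v)) ?size_poly //.
rewrite /take_poly poly_def mulr_suml coef_sum; apply: eq_bigr => k _.
by rewrite [Q _ _]mxE coef_rVpoly_ord -scalerAl coefZ /= subnKC //; lia.
Qed.

(** * Limits and estimates along real sequences *)

(** [p(x) / x^s] is the reversed polynomial evaluated at [1/x], which is continuous at 0. The
    exponent [s] may exceed the degree; the limit is then 0. *)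
Lemma horner_ratio_cvg (R : realType) (X : R^nat) (p : {poly R}) (s : nat) :
  X @ \oo --> +oo -> (size p <= s.+1)%N ->
  p.[X n] / X n ^+ s @[n --> \oo] --> p`_s.
Proof.
move=> Xoo szp; pose q := \poly_(i < s.+1) p`_(s - i).
have Xpos : \forall n \near \oo, 0 < X n by exact: cvgry_gt.
have X0 : (X n)^-1 @[n --> \oo] --> 0 by exact/gtr0_cvgV0.
have -> : p`_s = q.[0] by rewrite horner_coef0 coef_poly subn0.
have : q.[(X n)^-1] @[n --> \oo] --> q.[0].
  by apply: (cvg_comp _ _ X0); exact: continuous_horner.
apply: cvg_trans; apply: near_eq_cvg; near=> n.
have Xn0 : X n != 0 by rewrite gt_eqF //; near: n.
rewrite (horner_coef_wide _ szp) /q horner_poly mulr_suml.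
rewrite (reindex_inj rev_ord_inj) /=; apply: eq_bigr => i _.
have i_s : (i <= s)%N by rewrite -ltnS.
rewrite subSS subKn // -mulrA; congr (_ * _).
have -> : X n ^+ s = X n ^+ i * X n ^+ (s - i) by rewrite -exprD subnKC.
by rewrite exprVn invfM mulVKf ?expf_neq0.
Unshelve. all: by end_near. Qed.

Lemma invX_cvg0 (R : realType) (b : R) : 1 < b -> (b ^+ n)^-1 @[n --> \oo] --> 0.
Proof.
move=> b1; under eq_cvg do rewrite -exprVn; apply: cvg_expr.
by rewrite ger0_norm ?invr_ge0 ?invf_lt1; lra.
Qed.

(** Since [2 eps <= b eps], the sequence [(l n - eps) / b^n] is nondecreasing and
    [(l n + eps) / b^n] nonincreasing from [N] on. They are adjacent, and their common limit [L]
    stays between them, which is the stated bound. *)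
Lemma near_geometric_cvg (R : realType) (b eps : R) (l : R^nat) (N : nat) :
  2 <= b -> 0 <= eps ->
  (forall n, (N <= n)%N -> `|l n.+1 - b * l n| <= eps) ->
  exists2 L : R, l n / b ^+ n @[n --> \oo] --> L &
    forall n, (N <= n)%N -> `|l n - L * b ^+ n| <= eps.
Proof.
move=> b2 eps0 lN.
have b0 n : 0 < b ^+ n by rewrite exprn_gt0 //; lra.
pose u n := (l (n + N)%N - eps) / b ^+ (n + N).
pose v n := (l (n + N)%N + eps) / b ^+ (n + N).
have und : {homo u : n m / (n <= m)%N >-> n <= m}.
  apply/nondecreasing_seqP => n.
  rewrite /u addSn exprS ler_pdivrMr // mulrAC ler_pdivlMr ?mulr_gt0 //; last by lra.
  rewrite mulrA ler_pM2r //; have := lN _ (leq_addl n N).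
  by rewrite ler_distl => /andP[]; nra.
have vni : {homo v : n m / (n <= m)%N >-> m <= n}.
  apply/nonincreasing_seqP => n.
  rewrite /v addSn exprS ler_pdivrMr ?mulr_gt0 //; last by lra.
  rewrite mulrAC ler_pdivlMr // mulrA ler_pM2r //; have := lN _ (leq_addl n N).
  by rewrite ler_distl => /andP[]; nra.
have geoN (c : R) : c * (b ^+ (n + N))^-1 @[n --> \oo] --> 0.
  rewrite -(mulr0 c); apply: cvgM; first exact: cvg_cst.
  by rewrite (cvg_shiftn N (fun n => (b ^+ n)^-1)); apply: invX_cvg0; lra.
have vu : (v - u) n @[n --> \oo] --> 0.
  have -> : (v - u : R^nat) = (fun n => (2 * eps) * (b ^+ (n + N))^-1).
    apply/funext => n; rewrite /= /GRing.add /= /GRing.opp /= /u /v; lra.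
  exact: geoN.
have [Lvu cu cv] := adjacent_seq und vni vu.
exists (limn u).
  rewrite -(cvg_shiftn N).
  have -> : [sequence l (n + N)%N / b ^+ (n + N)]_n = (fun n => u n + eps * (b ^+ (n + N))^-1).
    apply/funext => n; rewrite /= /u; lra.
  by rewrite -[limn u]addr0; apply: cvgD (geoN eps).
move=> n Nn; rewrite ler_distl.
have := nondecreasing_cvgn_le und cu (n - N); have := nonincreasing_cvgn_ge vni cv (n - N).
rewrite Lvu /u /v subnK // ler_pdivlMr // ler_pdivrMr //; lra.
Qed.

(** The inequality [ln t <= t - 1] is applied at [w] and at [1/w], with [1/w <= 2]. *)
Lemma ln_dist_le (R : realType) (w : R) : `|w - 1| <= 2^-1 -> `|ln w| <= 2 * `|w - 1|.
Proof.
move=> hw; have w0 : 0 < w by move: hw; rewrite ler_distl => /andP[]; lra.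
have w1 : ln w <= w - 1 by rewrite -{1}(subrKC 1 w) le_ln1Dx //; lra.
have : ln w^-1 <= w^-1 - 1.
  by rewrite -{1}(subrKC 1 w^-1) le_ln1Dx // ltrBrDr addNr invr_gt0.
rewrite lnV ?posrE // => w2.
have w3 : w^-1 <= 2 by rewrite invf_ple ?posrE //; move: hw; rewrite ler_distl => /andP[]; lra.
have w4 : w^-1 - 1 = w^-1 * (1 - w) by field; lra.
have [h|h] := leP 1 w.
  rewrite [`|w - 1|]ger0_norm ?subr_ge0 // ler_norml; apply/andP; split; nra.
rewrite [`|w - 1|]ltr0_norm ?subr_lt0 // ler_norml; apply/andP; split; nra.
Qed.

Lemma expR_dist_le (R : realType) (w : R) : `|w| <= 2^-1 -> `|expR w - 1| <= 2 * `|w|.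
Proof.
move=> hw; have := expR_ge1Dx w; have := expR_ge1Dx (- w).
rewrite expRN => h1 h2.
have e0 := expR_gt0 w.
have h3 : (1 - w) * expR w <= 1 by rewrite -ler_pdivlMr // div1r.
move: hw; have [h|h] := leP 0 w; [rewrite ger0_norm // | rewrite ltr0_norm //] => hw;
  rewrite ler_norml; apply/andP; split; nra.
Qed.

(** * Approximate conjugacy of the orbit to the [d]-th power map *)

(** Up to a factor [1 + O(X^-k)], [z = a v] satisfies [z_(n+1) = z_n^d]. Its logarithm is thus
    multiplied by [d] up to a small error, which is the situation of [near_geometric_cvg]. *)
Lemma conjugate_asymp (R : realType) (d k : nat) (a C : R) (X v : R^nat) :
  (1 < d)%N -> (0 < k)%N -> 0 < a -> 0 <= C -> X @ \oo --> +oo ->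
  (\forall n \near \oo, X n <= X n.+1) ->
  (\forall n \near \oo, 0 < v n) ->
  (\forall n \near \oo,
     X n ^+ k * `|v n.+1 / (a ^+ d.-1 * v n ^+ d) - 1| <= C) ->
  exists L : R,
    \forall n \near \oo, X n ^+ k * `|a * v n / expR (L * d%:R ^+ n) - 1| <= 4 * C.
Proof.
move=> d1 k0 a0 C0 Xoo Xmon vpos hC.
(* The bound [4 C <= X n] gives [C / X_n^k <= 1/4], so that the estimates of [ln] near 1 and [expR]
   near 0 apply within their radius [1/2]. *)
have : \forall n \near \oo, [/\ 1 <= X n, 4 * C <= X n, X n <= X n.+1, 0 < v n &
    X n ^+ k * `|v n.+1 / (a ^+ d.-1 * v n ^+ d) - 1| <= C].
  near=> n; split; near: n => //; exact: cvgry_ge.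
case=> N _ HN.
pose l n := ln (a * v n).
pose w n := v n.+1 / (a ^+ d.-1 * v n ^+ d).
have Xle n j : (N <= n)%N -> X n <= X (n + j)%N.
  move=> Nn; elim: j => [|j IH]; first by rewrite addn0.
  rewrite addnS (le_trans IH) //; case: (HN (n + j)%N) => //=; lia.
have Xk n : (N <= n)%N -> X n <= X n ^+ k.
  move=> /HN[X1 *]; rewrite -[leLHS]expr1 ler_weXn2l //.
have wle n : (N <= n)%N -> `|w n - 1| <= C / X n ^+ k.
  move=> Nn; case: (HN n Nn) => X1 _ _ _.
  by rewrite mulrC -ler_pdivlMr // exprn_gt0 //; lra.
have epsle n : (N <= n)%N -> C / X n ^+ k <= 4^-1.
  move=> Nn; case: (HN n Nn) => X1 X2 _ _ _; have := Xk n Nn => h.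
  rewrite ler_pdivrMr; lra.
have lstep n : (N <= n)%N -> `|l n.+1 - d%:R * l n| <= 2 * (C / X n ^+ k).
  move=> Nn; case: (HN n Nn) => _ _ _ v0 _.
  case: (HN n.+1) => [|_ _ _ v1 _]; first exact: leq_trans Nn _.
  have -> : l n.+1 - d%:R * l n = ln (w n).
    rewrite /l /w mulr_natl -lnXn ?mulr_gt0 // -ln_div ?posrE ?exprn_gt0 ?mulr_gt0 //.
    congr ln; rewrite exprMn.
    have -> : a ^+ d = a * a ^+ d.-1 by rewrite -exprS prednK // ltnW.
    field.
    by rewrite !expf_neq0 ?gt_eqF.
  have hw := wle n Nn; have h4 := epsle n Nn.
  have w2 : `|w n - 1| <= 2^-1 by lra.
  have := ln_dist_le _ _ w2; lra.
have d2 : 2 <= d%:R :> R by rewrite ler_nat.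
have epsmon n j : (N <= n)%N -> C / X (n + j)%N ^+ k <= C / X n ^+ k.
  move=> Nn; case: (HN n Nn) => X1 _ _ _ _; have := Xle n j Nn => h.
  rewrite ler_wpM2l // lef_pV2 ?posrE ?exprn_gt0 ?lerXn2r ?nnegrE; lra.
have eps0 n : (N <= n)%N -> 0 <= 2 * (C / X n ^+ k).
  by move=> Nn; case: (HN n Nn) => X1 _ _ _ _; rewrite mulr_ge0 ?divr_ge0 ?exprn_ge0; lra.
(* The geometric lemma is restarted at each [n]: as [X] is nondecreasing, all later errors are
   bounded by the one at [n], so the bound decays with [X n]. Uniqueness of the limit then
   identifies the [L] of every restart. *)
have limn n : (N <= n)%N -> exists2 L : R, l n / d%:R ^+ n @[n --> \oo] --> L &
    `|l n - L * d%:R ^+ n| <= 2 * (C / X n ^+ k).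
  move=> Nn; have [j nj|L lL hL] := near_geometric_cvg _ _ _ l n d2 (eps0 n Nn).
    have Nj := leq_trans Nn nj.
    by apply: le_trans (lstep j Nj) _; rewrite ler_pM2l // -(subnKC nj) epsmon.
  by exists L => //; apply: hL.
have [L lL _] := limn N (leqnn N).
exists L; exists N => // n Nn.
case: (HN n Nn) => X1 _ _ v0 _.
have [L' lL' hL'] := limn n Nn.
have LL : L' = L by exact: (cvg_unique _ lL' lL).
rewrite {}LL in hL'.
have -> : a * v n / expR (L * d%:R ^+ n) = expR (l n - L * d%:R ^+ n).
  by rewrite expRB /l lnK // posrE mulr_gt0.
have := epsle n Nn => h4.
rewrite mulrC -ler_pdivlMr ?exprn_gt0; last by lra.
have h2 : `|l n - L * d%:R ^+ n| <= 2^-1 by lra.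
have := expR_dist_le _ _ h2; lra.
Unshelve. all: by end_near. Qed.

Lemma lead_coef_gt0_of_cvg (R : realType) (d : nat) (p : {poly R}) (X : R^nat) :
  size p = d.+1 -> (forall n, X n.+1 = p.[X n]) ->
  X @ \oo --> +oo -> 0 < lead_coef p.
Proof.
move=> szp Xrec Xoo.
have aE : p`_d = lead_coef p by rewrite lead_coefE szp.
have a0 : lead_coef p != 0 by rewrite lead_coef_eq0 -size_poly_eq0 szp.
have := horner_ratio_cvg R X p d Xoo; rewrite szp aE => /(_ (leqnn _)) cvgp.
have Xoo1 : X n.+1 @[n --> \oo] --> +oo by rewrite (cvg_shiftS X).
rewrite lt_neqAle eq_sym a0 /=.
apply: (cvgr_to_ge cvgp); near=> n; rewrite -Xrec divr_ge0 ?exprn_ge0 //.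
  by near: n; exact: cvgry_ge.
by near: n; exact: cvgry_ge.
Unshelve. all: by end_near. Qed.

(** Eventually [p(x) >= (a/2) x^d >= (a/2) x^2 >= x], the last step as soon as [x >= 2/a]. *)
Lemma iter_near_le (R : realType) (d : nat) (p : {poly R}) (X : R^nat) :
  (1 < d)%N -> size p = d.+1 -> (forall n, X n.+1 = p.[X n]) ->
  X @ \oo --> +oo -> \forall n \near \oo, X n <= X n.+1.
Proof.
move=> d1 szp Xrec Xoo.
have aE : p`_d = lead_coef p by rewrite lead_coefE szp.
have a0 := lead_coef_gt0_of_cvg R d p X szp Xrec Xoo.
have := horner_ratio_cvg R X p d Xoo; rewrite szp aE => /(_ (leqnn _)) cvgp.
have ha : lead_coef p / 2 < lead_coef p by lra.
near=> n.
have X1 : 1 <= X n by near: n; exact: cvgry_ge.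
have X2 : 2 / lead_coef p <= X n by near: n; exact: cvgry_ge.
have : lead_coef p / 2 <= p.[X n] / X n ^+ d by near: n; exact: (cvgr_ge _ cvgp _ ha).
rewrite -Xrec ler_pdivlMr ?exprn_gt0; last by lra.
apply: le_trans.
have Xd : X n ^+ 2 <= X n ^+ d by rewrite ler_weXn2l.
rewrite ler_pdivrMr // in X2.
nra.
Unshelve. all: by end_near. Qed.

Lemma exprn_cvg (R : realType) (f : R^nat) (l : R) (k : nat) :
  f @ \oo --> l -> f n ^+ k @[n --> \oo] --> l ^+ k.
Proof.
by move=> fl; exact: (cvg_comp f (fun x => x ^+ k) fl (@exprn_continuous R k l)).
Qed.

(** With [v = T / X^m], the relative error of [v_(n+1)] against [a^(d-1) v_n^d] is exactly
    [S / (a^(d-1) T^d p^m)], and the size bound on [S] makes this [O(X^-(m+1))]. *)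
Lemma poly_conjugate_asymp (R : realType) (d m : nat) (p T : {poly R}) (X : R^nat) :
  (1 < d)%N -> size p = d.+1 -> (forall n, X n.+1 = p.[X n]) ->
  X @ \oo --> +oo -> T \is monic -> size T = (m + d)%N ->
  (size ((T \Po p) * 'X^(d * m) - lead_coef p ^+ d.-1 *: (T ^+ d * p ^+ m))%R
     <= d * (2 * m + d.-1) - m)%N ->
  exists L C : R,
    \forall n \near \oo, X n ^+ m.+1 *
      `|lead_coef p * (T.[X n] / X n ^+ m) / expR (L * d%:R ^+ n) - 1| <= C.
Proof.
move=> d1 szp Xrec Xoo Tmon szT.
set S := (X in size (polyseq X)) => szS.
have a0 := lead_coef_gt0_of_cvg R d p X szp Xrec Xoo.
have Xmon := iter_near_le R d p X d1 szp Xrec Xoo.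
set a := lead_coef p in a0 *.
have Xoo1 : X n.+1 @[n --> \oo] --> +oo by rewrite (cvg_shiftS X).
pose e := d.-1; have dE : d = e.+1 by rewrite /e prednK // ltnW.
have e0 : (0 < e)%N by lia.
have cvgp : p.[X n] / X n ^+ d @[n --> \oo] --> a.
  by rewrite /a lead_coefE szp /=; apply: horner_ratio_cvg => //; rewrite szp.
have cvgT : T.[X n] / X n ^+ (m + e) @[n --> \oo] --> (1 : R).
  have <- : T`_(m + e) = 1 by rewrite -(eqP Tmon) lead_coefE szT dE addnS.
  by apply: horner_ratio_cvg => //; rewrite szT dE addnS.
(* [T^d p^m] has degree [d (2 m + e)], that is [s + m + 1], and [s] bounds the degree of [S]. *)
pose s := (d * (2 * m + e) - m.+1)%N.
have cvgS : S.[X n] / X n ^+ s @[n --> \oo] --> S`_s.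
  apply: horner_ratio_cvg => //; apply: leq_trans szS _; rewrite /s /e; nia.
have Tpos : \forall n \near \oo, 0 < T.[X n].
  near=> n.
  have X1 : 0 < X n by near: n; exact: cvgry_gt.
  have : 0 < T.[X n] / X n ^+ (m + e) by near: n; apply: (cvgr_gt _ cvgT).
  by rewrite pmulr_lgt0 // invr_gt0 exprn_gt0.
pose v n := T.[X n] / X n ^+ m.
have vpos : \forall n \near \oo, 0 < v n.
  near=> n; rewrite divr_gt0 ?exprn_gt0 //; near: n => //; exact: cvgry_gt.
(* This is [X^(m+1)] times the signed relative error, written with quotients that each converge;
   hence it is bounded. *)
pose g n := S.[X n] / X n ^+ s
  / (a ^+ e * ((T.[X n] / X n ^+ (m + e)) ^+ d * (p.[X n] / X n ^+ d) ^+ m)).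
have cvgg : g n @[n --> \oo] --> S`_s / (a ^+ e * (1 ^+ d * a ^+ m)).
  apply: cvgM => //; apply: cvgV.
    by rewrite expr1n mul1r mulf_neq0 ?expf_neq0 ?gt_eqF.
  apply: cvgM; first exact: cvg_cst.
  by apply: cvgM; apply: exprn_cvg.
set l := S`_s / _ in cvgg.
have gC : \forall n \near \oo, `|g n| <= `|l| + 1.
  have hl : `|l| < `|l| + 1 by rewrite ltrDl.
  by near=> n; near: n; exact: (cvgr_norm_le _ cvgg _ hl).
have [||L hL] := conjugate_asymp R d m.+1 a (`|l| + 1) X v d1 (ltn0Sn m) a0 _ Xoo Xmon vpos.
- by rewrite addr_ge0.
- near=> n.
  have X1 : 0 < X n by near: n; exact: cvgry_gt.
  have Y1 : 0 < X n.+1 by near: n; exact: cvgry_gt.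
  have T0 : 0 < T.[X n] by near: n.
  suff -> : X n ^+ m.+1 * `|v n.+1 / (a ^+ d.-1 * v n ^+ d) - 1| = `|g n| by near: n.
  rewrite -{1}(ger0_norm (ltW (exprn_gt0 m.+1 X1))) -normrM; congr (`|_|).
  rewrite /g /v Xrec /S hornerD hornerN hornerZ !hornerM !horner_exp hornerX horner_comp -/e -/a.
  rewrite -Xrec !expr_div_n -!exprM.
  set A := X n ^+ m.+1; set B := X n ^+ s; set E := X n ^+ (d * m).
  set G := X n ^+ ((m + e) * d).
  have AB : G = A * B / E.
    apply/(canRL (mulfK _)); first by rewrite expf_neq0 ?gt_eqF.
    by rewrite -!exprD; congr (_ ^+ _); rewrite /s; nia.
  rewrite {}AB ![(m * d)%N]mulnC -/E.
  field.
  by rewrite ?mulf_neq0 ?expf_neq0 ?gt_eqF.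
by exists L, (4 * (`|l| + 1)).
Unshelve. all: by end_near. Qed.

(** Recovers [L] from the growth of [z]. It serves both to show that [L] does not depend on the
    approximant and to compute the limit of the roots. *)
Lemma ln_ratio_cvg (R : realType) (d : nat) (z : R^nat) (L : R) :
  (1 < d)%N -> z n / expR (L * d%:R ^+ n) @[n --> \oo] --> (1 : R) ->
  ln (z n) / d%:R ^+ n @[n --> \oo] --> L.
Proof.
move=> d1 zL; have d1R : 1 < d%:R :> R by rewrite ltr1n.
have := @continuous_ln R 1 ltr01 => ln1c.
have h : ln (z n / expR (L * d%:R ^+ n)) * (d%:R ^+ n)^-1 + L @[n --> \oo]
    --> (ln (1 : R) * 0 + L).
  apply: cvgD; last exact: cvg_cst.
  by apply: cvgM; [exact: (cvg_comp _ _ zL ln1c)|exact: invX_cvg0].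
rewrite mulr0 add0r in h.
apply: cvg_trans h; apply: near_eq_cvg; near=> n.
have z0 : 0 < z n.
  have : 0 < z n / expR (L * d%:R ^+ n) by near: n; apply: (cvgr_gt _ zL); exact: ltr01.
  by rewrite pmulr_lgt0 // invr_gt0 expR_gt0.
rewrite /= ln_div ?posrE ?expR_gt0 // expRK mulrBl mulfK ?subrK //.
by rewrite expf_neq0 // gt_eqF //; lra.
Unshelve. all: by end_near. Qed.

(** One [L] has to serve all orders [m], since the order is chosen only later. With
    [alpha = exp(L / (d-1))], the quantity [exp(L d^n)] is [alpha^((d-1) d^n)]. *)
Lemma boettcher_limit (R : realType) (d : nat) (p : {poly R}) (X : R^nat) :
  (1 < d)%N -> size p = d.+1 -> (forall n, X n.+1 = p.[X n]) ->
  X @ \oo --> +oo ->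
  exists L : R, [/\ 0 < L,
    lead_coef p * X n ^+ d.-1 / expR (L * d%:R ^+ n) @[n --> \oo] --> (1 : R) &
    forall (m : nat) (T : {poly R}), T \is monic -> size T = (m + d)%N ->
      (size ((T \Po p) * 'X^(d * m)
              - lead_coef p ^+ d.-1 *: (T ^+ d * p ^+ m))%R
         <= d * (2 * m + d.-1) - m)%N ->
      exists C : R, \forall n \near \oo, X n ^+ m.+1 *
        `|lead_coef p * (T.[X n] / X n ^+ m) / expR (L * d%:R ^+ n) - 1| <= C].
Proof.
move=> d1 szp Xrec Xoo.
have a0 := lead_coef_gt0_of_cvg R d p X szp Xrec Xoo.
set a := lead_coef p in a0 *.
have Xinv : (X n)^-1 @[n --> \oo] --> 0.
  by apply/gtr0_cvgV0 => //; exact: cvgry_gt.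
have main (m : nat) (T : {poly R}) : T \is monic -> size T = (m + d)%N ->
    (size ((T \Po p) * 'X^(d * m) - a ^+ d.-1 *: (T ^+ d * p ^+ m))%R
         <= d * (2 * m + d.-1) - m)%N ->
    exists L C : R, a * X n ^+ d.-1 / expR (L * d%:R ^+ n) @[n --> \oo] --> (1 : R) /\
      \forall n \near \oo, X n ^+ m.+1 *
        `|a * (T.[X n] / X n ^+ m) / expR (L * d%:R ^+ n) - 1| <= C.
  move=> Tmon szT szS.
  have [L [C hC]] := poly_conjugate_asymp R d m p T X d1 szp Xrec Xoo Tmon szT szS.
  exists L, C; split => //.
  pose r n := a * (T.[X n] / X n ^+ m) / expR (L * d%:R ^+ n).
  have r1 : r n @[n --> \oo] --> (1 : R).
    have r10 : `|C| * (X n)^-1 @[n --> \oo] --> 0.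
      by rewrite -(mulr0 `|C|); apply: cvgM => //; exact: cvg_cst.
    apply/cvgrPdist_le => eps eps0; near=> n.
    have X1 : 1 <= X n by near: n; exact: cvgry_ge.
    have X2 : X n <= X n ^+ m.+1 by rewrite -[leLHS]expr1 ler_weXn2l.
    have h : X n ^+ m.+1 * `|r n - 1| <= C by near: n.
    have h2 : `|C| * (X n)^-1 <= eps.
      by apply: ltW; near: n; exact: (cvgr_lt _ r10).
    rewrite distrC; apply: le_trans h2; rewrite ler_pdivlMr; last by lra.
    have := ler_norm C; have := normr_ge0 (r n - 1); nra.
  have szT1 : (size T <= (m + d.-1).+1)%N by rewrite szT -addnS prednK // ltnW.
  have t1 : T.[X n] / X n ^+ (m + d.-1) @[n --> \oo] --> (1 : R).
    have <- : T`_(m + d.-1) = 1.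
      by rewrite -(eqP Tmon) lead_coefE szT -[in RHS](prednK (ltnW d1)) addnS.
    exact: horner_ratio_cvg.
  have h : r n * (T.[X n] / X n ^+ (m + d.-1))^-1 @[n --> \oo] --> (1 * 1^-1 : R).
    by apply: cvgM => //; apply: cvgV => //; exact: oner_neq0.
  rewrite invr1 mulr1 in h.
  apply: cvg_trans h; apply: near_eq_cvg; near=> n.
  have X1 : 0 < X n by near: n; exact: cvgry_gt.
  have T0 : 0 < T.[X n] / X n ^+ (m + d.-1).
    by near: n; apply: (cvgr_gt _ t1); exact: ltr01.
  have T1 : T.[X n] != 0 by apply: contraTneq T0 => ->; rewrite mul0r ltxx.
  rewrite /r /= exprD; field.
  by rewrite T1 !expf_neq0 ?lt0r_neq0 ?expR_gt0.
(* The approximant of order 0 fixes [L]; every other order yields the same value, because the growth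
   of [a X^(d-1)] determines it. *)
have [T0 [T0mon szT0 szS0]] := boettcher_approx R d 0 p d1 szp.
have [L [C [hL _]]] := main 0%N T0 T0mon szT0 szS0.
exists L; split => //; last first.
  move=> m T Tmon szT szS; have [L' [C' [hL' hC']]] := main m T Tmon szT szS.
  have -> : L = L'.
    exact: (cvg_unique _ (ln_ratio_cvg R d _ L d1 hL) (ln_ratio_cvg R d _ L' d1 hL')).
  by exists C'.
(* If [L <= 0], then [exp(L d^n) <= 1] while [a X^(d-1)] exceeds 2, so their ratio cannot tend to
   1. *)
rewrite ltNge; apply/negP => L0.
suff : \forall n \near \oo, False by case=> N _ /(_ N (leqnn N)).
have h12 : (1 : R) < 2 by lra.
near=> n.
have X1 : 1 <= X n by near: n; exact: cvgry_ge.
have X2 : 2 / a < X n by near: n; exact: cvgry_gt.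
have : a * X n ^+ d.-1 / expR (L * d%:R ^+ n) < 2.
  by near: n; exact: (cvgr_lt _ hL).
have X3 : X n <= X n ^+ d.-1 by rewrite -[leLHS]expr1 ler_weXn2l //; lia.
have e1 : expR (L * d%:R ^+ n) <= 1.
  by rewrite -expR0 ler_expR mulr_le0_ge0 // exprn_ge0.
rewrite ltr_pdivrMr ?expR_gt0 // => h.
rewrite ltr_pdivrMr // mulrC in X2.
rewrite -(ler_pM2l a0) in X3.
move: (a * _ ^+ _) (expR _) X3 e1 h => u w; lra.
Unshelve. all: by end_near. Qed.

(** * Pade forms evaluated along the orbit *)

Lemma horner_near_bounded (R : realType) (X : R^nat) (p : {poly R}) (s : nat) :
  X @ \oo --> +oo -> (size p <= s.+1)%N ->
  exists2 C : R, 0 < C & \forall n \near \oo, `|p.[X n]| <= C * X n ^+ s.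
Proof.
move=> Xoo szp; have h := horner_ratio_cvg R X p s Xoo szp.
exists (`|p`_s| + 1); first by rewrite ltr_pwDr.
have hl : `|p`_s| < `|p`_s| + 1 by rewrite ltrDl.
near=> n.
have X1 : 0 < X n by near: n; exact: cvgry_gt.
rewrite -ler_pdivrMr ?exprn_gt0 //.
rewrite -[leLHS](ger0_norm (divr_ge0 (normr_ge0 _) (exprn_ge0 _ (ltW X1)))).
rewrite normrM normr_id normfV -normf_div.
by near: n; exact: (cvgr_norm_le _ h _ hl).
Unshelve. all: by end_near. Qed.

(** The Pade form of [T / X^m] is transferred to [exp(L d^n)], which [a T / X^m] approximates at
    [x_n]. The coefficients stay rational so that denominators can be cleared later. *)
Lemma pade_asymp (R : realType) (d M : nat) (P : {poly rat}) (X : R^nat) (L : R) :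
  (1 < d)%N -> (0 < M)%N -> size P = d.+1 -> X @ \oo --> +oo ->
  let a : R := ratr (lead_coef P) in
  0 < a ->
  a * X n ^+ d.-1 / expR (L * d%:R ^+ n) @[n --> \oo] --> (1 : R) ->
  (forall (m : nat) (T : {poly rat}), T \is monic -> size T = (m + d)%N ->
      (size ((T \Po P) * 'X^(d * m)
              - lead_coef P ^+ d.-1 *: (T ^+ d * P ^+ m))%R
         <= d * (2 * m + d.-1) - m)%N ->
      exists C : R, \forall n \near \oo, X n ^+ m.+1 *
        `|a * ((map_poly ratr T).[X n] / X n ^+ m) / expR (L * d%:R ^+ n) - 1| <= C) ->
  exists A B : {poly rat}, A != 0 /\ exists C : R, \forall n \near \oo,
    X n ^+ M * `|(map_poly ratr A).[X n] * expR (L * d%:R ^+ n)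
                 - (map_poly ratr B).[X n]| <= C.
Proof.
move=> d1 M0 szP Xoo a a0 hE hT.
have aE : a = ratr (lead_coef P) by [].
clearbody a.
(* Replacing [a T / X^m] by [E = exp(L d^n)] costs [|A| E O(X^-(m+1))], where [A = O(X^M)] and
   [E = O(X^e)]; order [2 M + e] is enough to make this [O(X^-M)]. *)
pose e := d.-1; pose m := (2 * M + e)%N.
have [T [Tmon szT szS]] := boettcher_approx _ d m P d1 szP.
have [C2 hC2] := hT m T Tmon szT szS.
have Mm : (0 < M <= m)%N by rewrite M0 /m; lia.
have [A [B [A0 szA szW]]] := pade_approx _ T M m Mm.
exists A, (lead_coef P *: B); split => //.
pose AR := map_poly (ratr : rat -> R) A; pose BR := map_poly (ratr : rat -> R) B.
pose TR := map_poly (ratr : rat -> R) T.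
pose WR := AR * TR - BR * 'X^m.
have szWR : (size WR <= (m - M).+1)%N.
  by rewrite /WR -(map_polyXn (@ratr R)) -!rmorphM -rmorphB size_map_poly.
have [K1 K10 hK1] := horner_near_bounded R X WR (m - M) Xoo szWR.
have szAR : (size AR <= M.+1)%N by rewrite size_map_poly ltnW.
have [K2 K20 hK2] := horner_near_bounded R X AR M Xoo szAR.
have h12 : (2^-1 : R) < 1 by lra.
exists (2 * a * K2 * C2 + a * K1); near=> n.
have X1 : 1 <= X n by near: n; exact: cvgry_ge.
have X0 k : 0 < X n ^+ k by rewrite exprn_gt0 //; lra.
have hEn : 2^-1 < a * X n ^+ e / expR (L * d%:R ^+ n).
  by near: n; exact: (cvgr_gt _ hE).
have h2 : X n ^+ m.+1 * `|a * (TR.[X n] / X n ^+ m) / expR (L * d%:R ^+ n) - 1| <= C2.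
  by near: n.
pose v := TR.[X n] / X n ^+ m; rewrite -/v in h2.
set E := expR (L * d%:R ^+ n) in hEn h2 *.
have E0 : 0 < E by exact: expR_gt0.
have {}hEn : E <= 2 * a * X n ^+ e by move: hEn; rewrite ltr_pdivlMr //; lra.
have h3 : `|AR.[X n]| <= K2 * X n ^+ M by near: n.
have h4 : `|WR.[X n]| <= K1 * X n ^+ (m - M) by near: n.
have -> : (map_poly ratr (lead_coef P *: B)).[X n] = a * BR.[X n].
  by rewrite map_polyZ hornerZ aE.
rewrite -/AR.
(* The first term is the error of the Boettcher approximant, the second that of the Pade
   remainder. *)
have -> : AR.[X n] * E - a * BR.[X n]
   = - (AR.[X n] * E * (a * v / E - 1)) + a * (WR.[X n] / X n ^+ m).
  rewrite /WR hornerD hornerN !hornerM hornerXn /v; field.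
  by rewrite !gt_eqF.
have t1 : X n ^+ M * `|AR.[X n] * E * (a * v / E - 1)| <= 2 * a * K2 * C2.
  rewrite !normrM (gtr0_norm E0).
  set z := `|a * v / E - 1| in h2 *.
  have z0 : 0 <= z by exact: normr_ge0.
  apply: (@le_trans _ _ (X n ^+ M * (K2 * X n ^+ M * (2 * a * X n ^+ e) * z))).
    by rewrite ler_pM2l // ler_wpM2r // ler_pM // ltW.
  have -> : X n ^+ M * (K2 * X n ^+ M * (2 * a * X n ^+ e) * z)
     = (2 * a * K2) * (X n ^+ m * z).
    by rewrite /m mulSn mul1n !exprD; ring.
  have c0 : 0 < 2 * a * K2 by rewrite mulr_gt0 // mulr_gt0.
  rewrite ler_pM2l //.
  apply: le_trans h2; rewrite ler_wpM2r // ler_weXn2l //.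
have t2 : X n ^+ M * `|a * (WR.[X n] / X n ^+ m)| <= a * K1.
  rewrite !normrM normfV (gtr0_norm a0) (gtr0_norm (X0 m)) mulrCA ler_pM2l //.
  have -> : X n ^+ m = X n ^+ (m - M) * X n ^+ M.
    by rewrite -exprD subnK //; case/andP: Mm.
  rewrite mulrA ler_pdivrMr; last by rewrite mulr_gt0.
  by rewrite mulrA [leRHS]mulrC ler_pM2l.
apply: (@le_trans _ _ (X n ^+ M * (`|AR.[X n] * E * (a * v / E - 1)|
   + `|a * (WR.[X n] / X n ^+ m)|))).
  by rewrite ler_pM2l // (le_trans (ler_normD _ _)) // normrN.
by rewrite mulrDr lerD.
Unshelve. all: by end_near. Qed.

(** Dividing by [H = gcd(A, B)] preserves the estimate: [|H(x)|] is at least half the absolute value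
    of its leading coefficient for large [x]. *)
Lemma pade_asymp_coprime (R : realType) (M : nat) (A B : {poly rat}) (X E : R^nat) :
  X @ \oo --> +oo -> A != 0 ->
  (exists C : R, \forall n \near \oo,
    X n ^+ M * `|(map_poly ratr A).[X n] * E n - (map_poly ratr B).[X n]| <= C) ->
  exists A1 B1 : {poly rat}, [/\ A1 != 0, coprimep A1 B1 & exists C : R,
    \forall n \near \oo,
    X n ^+ M * `|(map_poly ratr A1).[X n] * E n - (map_poly ratr B1).[X n]| <= C].
Proof.
move=> Xoo A0 [C hC].
pose H := gcdp A B.
have H0 : H != 0 by rewrite gcdp_eq0 negb_and A0.
have eA : A = A %/ H * H by rewrite divpK // dvdp_gcdl.
have eB : B = B %/ H * H by rewrite divpK // dvdp_gcdr.
exists (A %/ H), (B %/ H); split.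
- by apply: contraNneq A0 => h; rewrite eA h mul0r.
- by rewrite coprimep_div_gcd // A0.
pose HR := map_poly (ratr : rat -> R) H.
have HR0 : HR != 0 by rewrite map_poly_eq0.
have hH := horner_ratio_cvg R X HR (size HR).-1 Xoo (leqSpred _).
rewrite -lead_coefE in hH.
have l0 : 0 < `|lead_coef HR| / 2 by rewrite divr_gt0 // normr_gt0 lead_coef_eq0.
have ll : `|lead_coef HR| / 2 < `|lead_coef HR|.
  by rewrite ltr_pdivrMr // ltr_pMr ?ltr1n // normr_gt0 lead_coef_eq0.
exists (C / (`|lead_coef HR| / 2)); near=> n.
have X1 : 1 <= X n by near: n; exact: cvgry_ge.
have X0 k : 0 < X n ^+ k by rewrite exprn_gt0 //; lra.
have h1 : `|lead_coef HR| / 2 <= `|HR.[X n]|.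
  have h : `|lead_coef HR| / 2 <= `|HR.[X n] / X n ^+ (size HR).-1|.
    near: n; exact: (cvgr_ge _ (cvg_norm hH) _ ll).
  apply: le_trans h _; rewrite normrM normfV (gtr0_norm (X0 _)).
  by rewrite ler_pdivrMr // ler_peMr // exprn_ege1.
have h2 : X n ^+ M * `|(map_poly ratr A).[X n] * E n - (map_poly ratr B).[X n]| <= C.
  by near: n.
rewrite {1}eA {1}eB !rmorphM !hornerM -/HR mulrAC -mulrBl normrM mulrA in h2.
rewrite ler_pdivlMr //; apply: le_trans h2.
by rewrite ler_wpM2l // mulr_ge0 // ltW.
Unshelve. all: by end_near. Qed.

(** * Integrality and coprimality arguments for a rational limit *)

Lemma iterX_cvg0 (R : realType) (d c : nat) (b : R) :
  (1 < d)%N -> (0 < c)%N -> 0 <= b -> b < 1 -> b ^+ (c * d ^ n) @[n --> \oo] --> 0.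
Proof.
move=> d1 c0 b0 b1; have h := @cvg_expr R b; rewrite ger0_norm // in h.
apply: (squeeze_cvgr _ (cvg_cst 0) (h b1)); near=> n.
rewrite exprn_ge0 //= ler_wiXn2l // ?ltW //.
by rewrite (leq_trans (ltnW (ltn_expl n d1))) // leq_pmull.
Unshelve. all: by end_near. Qed.

(** If [b < 1] the powers tend to 0, and if [b > 1] their inverses do; either contradicts one of the
    two bounds. *)
Lemma iterX_bounded_eq1 (R : realType) (d c : nat) (b c1 c2 : R) :
  (1 < d)%N -> (0 < c)%N -> 0 < b -> 0 < c1 ->
  (\forall n \near \oo, c1 <= b ^+ (c * d ^ n) <= c2) -> b = 1.
Proof.
move=> d1 c0 b0 c10 hb.
have c20 : 0 < c2.
  by case: hb => N _ /(_ N (leqnn N)) /= /andP[h1 h2]; lra.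
case: (ltgtP b 1) => // hb1; exfalso.
  have h := iterX_cvg0 R d c b d1 c0 (ltW b0) hb1.
  suff : \forall n \near \oo, False by case=> N _ /(_ N (leqnn N)).
  near=> n.
  have : b ^+ (c * d ^ n) < c1 by near: n; exact: (cvgr_lt _ h).
  have : c1 <= b ^+ (c * d ^ n) <= c2 by near: n.
  by move=> /andP[h1 _] h2; lra.
have hb1' : b^-1 < 1 by rewrite invf_lt1.
have bi0 : 0 <= b^-1 by rewrite invr_ge0 ltW.
have h := iterX_cvg0 R d c b^-1 d1 c0 bi0 hb1'.
suff : \forall n \near \oo, False by case=> N _ /(_ N (leqnn N)).
have c2i : 0 < c2^-1 by rewrite invr_gt0.
near=> n.
have : b^-1 ^+ (c * d ^ n) < c2^-1 by near: n; exact: (cvgr_lt _ h).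
have : c1 <= b ^+ (c * d ^ n) <= c2 by near: n.
move=> /andP[h1 h2]; rewrite exprVn ltf_pV2 ?posrE ?exprn_gt0 //; lra.
Unshelve. all: by end_near. Qed.

(** Coprimality gives [f = w q] and [g = w p], so [w] divides every combination of [f] and [g], in
    particular [D]. *)
Lemma coprime_proportional (p q : nat) (f g u v D : int) :
  coprime p q -> (0 < q)%N -> D != 0 -> u * f + v * g = D ->
  f * p%:Z = g * q%:Z -> exists w : int, [/\ f = w * q%:Z, w != 0 & (`|w| <= `|D|)%N].
Proof.
move=> cpq q0 D0 bez fg.
have qf : (q %| f)%Z.
  have : (q %| f * p%:Z)%Z by rewrite fg dvdz_mull.
  by rewrite Gauss_dvdzl // /coprimez /gcdz /= gcdnC (eqP cpq).
have /dvdzP[w fE] := qf.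
have qz : q%:Z != 0 by rewrite eqz_nat -lt0n.
have gE : g = w * p%:Z.
  by apply: (mulIf qz); rewrite -fg fE; ring.
have wD : (w %| D)%Z.
  by apply/dvdzP; exists (u * q%:Z + v * p%:Z); rewrite -bez fE gE; ring.
exists w; split => //.
  by apply: contraNneq D0 => w0; rewrite -bez fE gE w0 !mul0r !mulr0.
by rewrite dvdn_leq // absz_gt0.
Qed.

Lemma horner_rat_scale (R : realType) (A : {poly rat}) (F : {poly int}) (c k : int) :
  A = c%:~R^-1 *: map_poly intr F ->
  (map_poly ratr A).[k%:~R] = (F.[k])%:~R / c%:~R :> R.
Proof.
have cE : ratr (c%:~R^-1) = (c%:~R)^-1 :> R by rewrite fmorphV /= ratr_int.
move=> ->; rewrite map_polyZ hornerZ /= cE -map_poly_comp /=.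
rewrite (eq_map_poly (fun z => ratr_int R z)) (horner_map (intr : int -> R)) mulrC.
by [].
Qed.

(** Clearing denominators in the Bezout identity [U A + V B = 1] gives a nonzero integer [D], the
    same for all [n], which later bounds the common factor of [F(x_n)] and [g n]. *)
Lemma coprime_integer_pade (R : realType) (M : nat) (A B : {poly rat}) (x : nat -> int)
    (E : R^nat) :
  A != 0 -> coprimep A B ->
  (exists C : R, \forall n \near \oo, (x n)%:~R ^+ M *
     `|(map_poly ratr A).[(x n)%:~R] * E n - (map_poly ratr B).[(x n)%:~R]| <= C) ->
  exists (F : {poly int}) (g u v : nat -> int) (D : int) (C : R),
    [/\ F != 0, D != 0, forall n, u n * F.[x n] + v n * g n = D &
      \forall n \near \oo, (x n)%:~R ^+ M * `|(F.[x n])%:~R * E n - (g n)%:~R| <= C].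
Proof.
move=> A0 /Bezout_eq1_coprimepP[[U V] /= bez] [C hC].
have [F [a a0 eA]] := rat_poly_scale A.
have [G [b b0 eB]] := rat_poly_scale B.
have [U' [u0 hu0 eU]] := rat_poly_scale U.
have [V' [v0 hv0 eV]] := rat_poly_scale V.
have F0 : F != 0.
  by apply: contraNneq A0 => F0; rewrite eA F0 map_poly0 scaler0.
have intr0 (k : int) : k != 0 -> (k%:~R : R) != 0 by rewrite intr_eq0.
(* With [A = F/a], [B = G/b], [U = U'/u0], [V = V'/v0], the approximants are multiplied by [a b] and
   the Bezout identity by [u0 v0 a b]. *)
exists (b%:P * F), (fun n => a * G.[x n]), (fun n => v0 * U'.[x n]),
  (fun n => u0 * V'.[x n]), (u0 * v0 * a * b), (C * `|(a * b)%:~R|); split.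
- by rewrite mulf_neq0 ?polyC_eq0.
- by rewrite !mulf_neq0.
- move=> n; apply: (@intr_inj R).
  have h := congr1 (fun p => (map_poly (ratr : rat -> R) p).[(x n)%:~R]) bez.
  rewrite /= rmorphD !rmorphM hornerD !hornerM rmorph1 hornerC /= in h.
  rewrite (horner_rat_scale R _ _ _ _ eA) (horner_rat_scale R _ _ _ _ eB) in h.
  rewrite (horner_rat_scale R _ _ _ _ eU) (horner_rat_scale R _ _ _ _ eV) in h.
  rewrite hornerM hornerC !(rmorphD, rmorphM) /= -[RHS]mulr1 -[X in _ = _ * X]h.
  by field; rewrite !intr0.
near=> n.
have : (x n)%:~R ^+ M *
     `|(map_poly ratr A).[(x n)%:~R] * E n - (map_poly ratr B).[(x n)%:~R]| <= C.
  by near: n.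
rewrite (horner_rat_scale R _ _ _ _ eA) (horner_rat_scale R _ _ _ _ eB) => h.
have -> : ((b%:P * F).[x n])%:~R * E n - (a * G.[x n])%:~R
   = ((F.[x n])%:~R / a%:~R * E n - (G.[x n])%:~R / b%:~R) * (a * b)%:~R.
  by rewrite hornerM hornerC !rmorphM /=; field; rewrite !intr0.
by rewrite normrM mulrA ler_wpM2r.
Unshelve. all: by end_near. Qed.

Lemma rational_growth (R : realType) (d : nat) (P : {poly rat}) (x : nat -> int)
    (L : R) (p q : nat) :
  let X : R^nat := fun n => (x n)%:~R in
  (1 < d)%N -> size P = d.+1 -> X @ \oo --> +oo ->
  0 < (ratr (lead_coef P) : R) -> 0 < L ->
  ratr (lead_coef P) * X n ^+ d.-1 / expR (L * d%:R ^+ n) @[n --> \oo] --> (1 : R) ->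
  (forall (m : nat) (T : {poly rat}), T \is monic -> size T = (m + d)%N ->
      (size ((T \Po P) * 'X^(d * m)
              - lead_coef P ^+ d.-1 *: (T ^+ d * P ^+ m))%R
         <= d * (2 * m + d.-1) - m)%N ->
      exists C : R, \forall n \near \oo, X n ^+ m.+1 *
        `|ratr (lead_coef P) * ((map_poly ratr T).[X n] / X n ^+ m)
           / expR (L * d%:R ^+ n) - 1| <= C) ->
  coprime p q -> (0 < q)%N -> expR (L / d.-1%:R) = p%:R / q%:R -> q = 1%N.
Proof.
move=> X d1 szP Xoo a0 L0 hE hT cpq q0 alphaE.
set a : R := ratr (lead_coef P) in a0 hE.
pose e := d.-1; have e0 : (0 < e)%N by rewrite /e; lia.
pose alpha : R := expR (L / e%:R).
have eR0 : 0 < e%:R :> R by rewrite ltr0n.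
have qR0 : 0 < q%:R :> R by rewrite ltr0n.
have alpha1 : 1 < alpha by rewrite expR_gt1 divr_gt0.
have alpha0 : 0 < alpha by lra.
pose E n := expR (L * d%:R ^+ n) : R.
have E0 n : 0 < E n by exact: expR_gt0.
have EE n : E n = alpha ^+ (e * d ^ n).
  rewrite /alpha -expRM_natl natrM natrX /E; congr expR; field.
  by rewrite gt_eqF.
have EpqE n : E n * q%:R ^+ (e * d ^ n) = p%:R ^+ (e * d ^ n).
  by rewrite EE /alpha alphaE -exprMn divfK // gt_eqF.
(* At order [e M] the error is [O(X^-(e M))], hence [O(E^-M)], since [E] is comparable to [X^e]. As
   [alpha^M > q], this beats the denominator [q^(e d^n)] of [E]; [beta] below is the ratio of the
   two rates. *)
have [M Mq] : exists M : nat, q%:R < alpha ^+ M.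
  have iq : 0 < q%:R^-1 :> R by rewrite invr_gt0.
  have [N _ /(_ N (leqnn N)) h] := cvgr_lt _ (invX_cvg0 R _ alpha1) _ iq.
  by exists N; rewrite ltf_pV2 ?posrE ?exprn_gt0 in h.
have M0 : (0 < e * M)%N.
  rewrite muln_gt0 e0 /= lt0n; apply: contraTneq Mq => ->.
  by rewrite expr0 -leNgt ler1n.
have [A0 [B0 [A00 hAB0]]] := pade_asymp R d (e * M) P X L d1 M0 szP Xoo a0 hE hT.
have [A [B [An0 cAB hAB]]] := pade_asymp_coprime R (e * M) A0 B0 X E Xoo A00 hAB0.
have [F [g [u [v [D [C [F0 D0 bez hFg]]]]]]] :=
  coprime_integer_pade R (e * M) A B x E An0 cAB hAB.
clear hT hAB0 hAB; clearbody a.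
have a20 : 0 < 2 * a by rewrite mulr_gt0.
pose s n := (e * d ^ n)%N.
have h12 : (2^-1 : R) < 1 by lra.
pose beta : R := q%:R / alpha ^+ M.
have beta0 : 0 <= beta by rewrite divr_ge0 // exprn_ge0 // ltW.
have beta1 : beta < 1 by rewrite ltr_pdivrMr ?exprn_gt0 // mul1r.
have hbeta : `|C| * (2 * a) ^+ M * beta ^+ s n @[n --> \oo] --> (0 : R).
  rewrite -(mulr0 (`|C| * (2 * a) ^+ M)); apply: cvgM; first exact: cvg_cst.
  exact: iterX_cvg0.
have fgE : \forall n \near \oo, F.[x n] * (p ^ s n)%N%:Z = g n * (q ^ s n)%N%:Z.
  near=> n.
  have X1 : 0 < X n by near: n; exact: cvgry_gt.
  have h1 : X n ^+ (e * M) * `|(F.[x n])%:~R * E n - (g n)%:~R| <= C by near: n.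
  have h2 : 2^-1 < a * X n ^+ d.-1 / E n by near: n; exact: (cvgr_gt _ hE).
  have h3 : `|C| * (2 * a) ^+ M * beta ^+ s n < 1 by near: n; exact: (cvgr_lt _ hbeta).
  have h4 : E n ^+ M <= (2 * a) ^+ M * X n ^+ (e * M).
    rewrite exprM -exprMn lerXn2r ?nnegrE ?ltW //; last first.
      by move: h2; rewrite ltr_pdivlMr // -/e; lra.
    by rewrite mulr_gt0 ?exprn_gt0.
  (* A nonzero integer has absolute value at least 1, whereas this difference equals
     [(F E - g) q^s], of size at most [|C| (2 a)^M beta^s < 1]. *)
  apply/eqP; rewrite -subr_eq0 -absz_eq0 -[_ == _]negbK -lt0n.
  apply/negP => k0.
  set k := _ - _ in k0.
  have k1 : 1 <= `|k%:~R : R| by rewrite -intr_norm -abszE -pmulrn ler1n.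
  have kE : k%:~R = ((F.[x n])%:~R * E n - (g n)%:~R) * q%:R ^+ s n :> R.
    rewrite /k rmorphB !rmorphM /= -!pmulrn !natrX -EpqE /s; ring.
  move: k1; rewrite kE normrM => k1.
  set z := `|_ - _| in h1 k1.
  have z0 : 0 <= z by exact: normr_ge0.
  have qs0 : 0 < q%:R ^+ s n :> R by rewrite exprn_gt0.
  rewrite (gtr0_norm qs0) in k1.
  have h5 : `|C| * (2 * a) ^+ M * q%:R ^+ s n < E n ^+ M.
    move: h3; rewrite /beta expr_div_n mulrA ltr_pdivrMr ?exprn_gt0 //.
    by rewrite mul1r EE -!exprM [(M * _)%N]mulnC.
  have h6 : E n ^+ M * z <= (2 * a) ^+ M * `|C|.
    apply: (@le_trans _ _ ((2 * a) ^+ M * X n ^+ (e * M) * z)).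
      by rewrite ler_wpM2r.
    have hC := le_trans h1 (ler_norm C).
    by rewrite -mulrA ler_pM2l ?exprn_gt0.
  have EM0 : 0 < E n ^+ M by rewrite exprn_gt0.
  have h7 : E n ^+ M <= E n ^+ M * z * q%:R ^+ s n by rewrite -mulrA ler_peMr // ltW.
  have h8 : E n ^+ M * z * q%:R ^+ s n <= (2 * a) ^+ M * `|C| * q%:R ^+ s n.
    by rewrite ler_pM2r.
  by have := lt_le_trans h5 (le_trans h7 h8); rewrite [`|C| * _]mulrC ltxx.
pose k := (size F).-1.
pose FR := map_poly (intr : int -> R) F.
have FRE n : FR.[X n] = (F.[x n])%:~R by rewrite horner_map.
have FRk : FR`_k = (lead_coef F)%:~R by rewrite coef_map lead_coefE.
have FR0 : 0 < `|FR`_k| by rewrite normr_gt0 FRk intr_eq0 lead_coef_eq0.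
have szFR : (size FR <= k.+1)%N.
  by rewrite (leq_trans (size_poly _ _)) // leqSpred.
(* The exponents are chosen so that the powers of [X n] cancel. What remains is
   [a^k |F(x_n)|^e / E^k], which has a positive limit and, once [F(x_n) = w q^s], equals
   [a^k |w|^e b^s]. *)
pose h n := `|FR.[X n] / X n ^+ k| ^+ e * (a * X n ^+ d.-1 / E n) ^+ k.
have cvgh : h n @[n --> \oo] --> (`|FR`_k| ^+ e * 1 ^+ k : R).
  apply: cvgM; apply: exprn_cvg => //.
  by apply: cvg_norm; exact: horner_ratio_cvg.
set kappa := _ * 1 ^+ k in cvgh.
have kappa0 : 0 < kappa by rewrite /kappa expr1n mulr1 exprn_gt0.
have kappa1 : kappa / 2 < kappa by rewrite ltr_pdivrMr // ltr_pMr ?ltr1n.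
have kappa2 : kappa < kappa * 2 by rewrite ltr_pMr ?ltr1n.
pose b : R := q%:R ^+ e / alpha ^+ k.
have b0 : 0 < b by rewrite divr_gt0 ?exprn_gt0.
have ak0 : 0 < a ^+ k by rewrite exprn_gt0.
have DR0 : 0 < (`|D|%N%:R : R) ^+ e by rewrite exprn_gt0 // ltr0n absz_gt0.
pose c1 := kappa / 2 / (a ^+ k * (`|D|%N%:R : R) ^+ e).
have c10 : 0 < c1 by rewrite !divr_gt0 // mulr_gt0.
have hb : \forall n \near \oo, c1 <= b ^+ (e * d ^ n) <= kappa * 2 / a ^+ k.
  near=> n.
  have X1 : 0 < X n by near: n; exact: cvgry_gt.
  have fg : F.[x n] * (p ^ s n)%N%:Z = g n * (q ^ s n)%N%:Z by near: n.
  have k1 : kappa / 2 < h n by near: n; exact: (cvgr_gt _ cvgh).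
  have k2 : h n < kappa * 2 by near: n; exact: (cvgr_lt _ cvgh).
  have cs : coprime (p ^ s n) (q ^ s n) by rewrite coprimeXl // coprimeXr.
  have qs : (0 < q ^ s n)%N by rewrite expn_gt0 q0.
  have [w [wE w0 wD]] := coprime_proportional _ _ _ _ _ _ _ cs qs D0 (bez n) fg.
  have hE' : h n = a ^+ k * `|w|%N%:R ^+ e * b ^+ s n.
    rewrite /h FRE wE rmorphM /= -pmulrn natrX !normrM normfV.
    rewrite (gtr0_norm (exprn_gt0 k X1)) (gtr0_norm (exprn_gt0 _ qR0)).
    rewrite -intr_norm -abszE -pmulrn /b !expr_div_n !exprMn EE -/e -/(s n).
    rewrite -!exprM [(k * e)%N]mulnC [(k * s n)%N]mulnC [(e * s n)%N]mulnC; field.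
    by rewrite !expf_neq0 ?gt_eqF.
  have wR1 : 1 <= (`|w|%N%:R : R) ^+ e by rewrite exprn_ege1 // ler1n absz_gt0.
  have wR2 : (`|w|%N%:R : R) ^+ e <= `|D|%N%:R ^+ e.
    by rewrite lerXn2r ?nnegrE ?ler0n // ler_nat.
  have bs0 : 0 < b ^+ s n by rewrite exprn_gt0.
  rewrite -/(s n); apply/andP; split.
    rewrite /c1 ler_pdivrMr ?mulr_gt0 // (le_trans (ltW k1)) // hE'.
    by rewrite mulrC ler_pM2l // ler_pM2l.
  rewrite ler_pdivlMr // (le_trans _ (ltW k2)) // hE' mulrC.
  by rewrite ler_pM2r // ler_peMr // ltW.
have bE := iterX_bounded_eq1 R d e b _ _ d1 e0 b0 c10 hb.
have pq : (q ^ (e + k) = p ^ k)%N.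
  apply/eqP; rewrite -(eqr_nat R) !natrX exprD; apply/eqP.
  have -> : q%:R ^+ e = alpha ^+ k.
    by apply: divr1_eq; exact: bE.
  by rewrite -exprMn /alpha alphaE divfK // gt_eqF.
(* Being equal to [p^k], the number [q^(e+k)] is coprime to itself, hence 1; as [e > 0], this forces
   [q = 1]. *)
have : coprime (q ^ (e + k)) (q ^ (e + k)).
  by rewrite {2}pq coprimeXl // coprimeXr // coprime_sym.
rewrite /coprime gcdnn => /eqP q1.
have [q_lt1|q_gt1|//] := ltngtP q 1%N; first by rewrite ltnS leqNgt q0 in q_lt1.
have := ltn_expl (e + k) q_gt1; rewrite q1 ltnS leqn0 addn_eq0 => /andP[/eqP e00 _].
by rewrite e00 in e0.
Unshelve. all: by end_near. Qed.

(** * The limit of the roots and its arithmetic nature *)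

Theorem theorem1 (R : realType) (d : nat) (P : {poly rat}) (x : nat -> int)
    (d_gt1 : (1 < d)%N) (degP : size P = d.+1)
    (x_rec : forall n : nat, (x n.+1)%:~R = P.[(x n)%:~R])
    (x_infty : ((x n)%:~R : R) @[n --> \oo] --> +oo) :
  let alpha : R := limn (iter_root R d x) in
  [/\ iter_root R d x @ \oo --> alpha,
      1 < alpha
    & irrational alpha \/ alpha \is a Num.int].
Proof.
pose X n : R := (x n)%:~R; pose p := map_poly (ratr : rat -> R) P.
have szp : size p = d.+1 by rewrite size_map_poly.
have Xrec n : X n.+1 = p.[X n].
  rewrite /X /p -[in RHS](ratr_int R) horner_map -x_rec.
  by rewrite /= ratr_int.
have pa : lead_coef p = ratr (lead_coef P) by rewrite lead_coef_map.
have a0 := lead_coef_gt0_of_cvg R d p X szp Xrec x_infty.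
have [L [L0 hL hT]] := boettcher_limit R d p X d_gt1 szp Xrec x_infty.
pose e := d.-1; have e0 : (0 < e)%N by rewrite /e; lia.
have eR0 : 0 < e%:R :> R by rewrite ltr0n.
have dR1 : 1 < d%:R :> R by rewrite ltr1n.
pose beta : R := expR (L / e%:R).
(* Where [X n > 0] the root is [exp(ln(X n) / d^n)]. In [ln(a X^e) / d^n], which tends to [L], the
   constant [ln a] disappears in the limit, and dividing by [e] undoes the [e]-th power. *)
have rootE : iter_root R d x @ \oo --> beta.
  have h := ln_ratio_cvg R d _ L d_gt1 hL.
  have h2 : (ln (lead_coef p * X n ^+ d.-1) / d%:R ^+ n - ln (lead_coef p) * (d%:R ^+ n)^-1)
      / e%:R @[n --> \oo] --> (L - ln (lead_coef p) * 0) / e%:R.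
    apply: cvgM; last exact: cvg_cst.
    apply: cvgB => //; apply: cvgM; first exact: cvg_cst.
    exact: invX_cvg0.
  rewrite mulr0 subr0 in h2.
  apply: cvg_trans (cvg_comp _ _ h2 (@continuous_expR R _)).
  apply: near_eq_cvg; near=> n.
  have X0 : 0 < X n by near: n; exact: cvgry_gt.
  rewrite /= /iter_root -/(X n) /powR gt_eqF //; congr expR.
  rewrite lnM ?posrE ?exprn_gt0 // lnXn // -/e -[_ *+ e]mulr_natl natrX; field.
  by rewrite expf_neq0 ?gt_eqF //; lra.
have -> : limn (iter_root R d x) = beta by exact: cvg_lim.
split => //; first by rewrite expR_gt1 divr_gt0.
have [/= [r _ rE]|] := pselect (rational beta); last by left.
right.
have r0 : 0 < r by rewrite -(ltr0q R) rE expR_gt0.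
have nE : numq r = `|numq r|%N%:Z by rewrite gez0_abs // ltW // numq_gt0.
have dE : denq r = `|denq r|%N%:Z by rewrite gez0_abs.
have q1 : `|denq r|%N = 1%N.
  apply: (rational_growth R d P x L `|numq r|%N `|denq r|%N) => //.
  - by rewrite -pa.
  - by rewrite -pa.
  (* The estimate is known for real polynomials; mapping a rational [T] to the reals commutes with
     the error expression and preserves sizes. *)
  - move=> m T Tmon szT szS; rewrite -pa.
    apply: (hT m (map_poly ratr T)); rewrite ?map_monic ?size_map_poly //.
    move: szS; rewrite -(size_map_poly (ratr : {rmorphism rat -> R})).
    rewrite rmorphB /= map_polyZ !rmorphM !rmorphXn  /=.
    by rewrite map_comp_poly map_polyX pa.
  - exact: coprime_num_den.
  - by rewrite absz_gt0.
  - by rewrite -/beta -rE /ratr [in LHS]nE [in LHS]dE -!pmulrn.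
by rewrite -rE /ratr dE q1 divr1 rpred_int.
Unshelve. all: by end_near. Qed.
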